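(* Let $\Delta=\bigsqcup_{i\in\mathbb Z}\Delta(i)$ be a $\mathbb Z$-grading of an irreducible reduced crystallographic root system with compatible positive system, simple roots $\Pi$ and Weyl group $W$. Then $$W^0_{\min}=\{w\in W^0\mid w^{-1}(\alpha)\in\Delta(\ge -1)\ \text{for all }\alpha\in\Pi\},$$ where $\Delta(\ge -1)=\bigsqcup_{j\ge -1}\Delta(j)$.
   Context: A $\mathbb Z$-grading: $\Delta=\bigsqcup_i\Delta(i)$ with $\gamma_1+\gamma_2\in\Delta(i_1+i_2)$ whenever $\gamma_j\in\Delta(i_j)$ and $\gamma_1+\gamma_2\in\Delta$; compatibility: $\Delta^+=\Delta(0)^+\sqcup\bigsqcup_{i\ge1}\Delta(i)$ with $\Delta(0)^+$ a positive system of $\Delta(0)$. Order: $\mu\preccurlyeq\gamma$ iff $\gamma-\mu$ is a nonnegative integer combination of simple roots; lower ideals of $\Delta(1)$ are its downward closed subsets. $N(w)=\{\gamma\in\Delta^+\mid w(\gamma)\in-\Delta^+\}$. $W^0=\{w\in W\mid w(\alpha)\in\Delta^+\ \forall\alpha\in\Delta(0)^+\}$. For $J\subset\Delta^+$: $J^1=J$, $J^k=(J+J^{k-1})\cap\Delta$, $\langle J\rangle=\bigcup_{k\ge1}J^k$. For a lower ideal $I$ of $\Delta(1)$, $w_{I,\min}$ is the unique $w\in W$ with $N(w)=\langle I\rangle$ (equivalently, the unique element of minimal length among $w\in W^0$ with $N(w)\cap\Delta(1)=I$). $W^0_{\min}=\{w_{I,\min}\mid I \text{ a lower ideal of }\D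elta(1)\}$.
   Formalization: The grading is also required to satisfy Δ(−i) = −Δ(i); this is automatic in rank at least 2, but in rank 1 the claim fails without it (e.g. deg α = 1, deg(−α) = −3). *)

(* Defs.v *)
From HB Require Import structures.
From mathcomp Require Import all_boot all_order all_algebra finmap ring reals.

Set Implicit Arguments.
Unset Strict Implicit.
Unset Printing Implicit Defensive.

Import Order.TTheory GRing.Theory Num.Theory.
Local Open Scope fset_scope.
Local Open Scope ring_scope.

Section Reflection.
Variables (R : realType) (V : vectType R) (ip : {dot V for idfun}).

Definition reflection_fun (a x : V) : V := x - (2 * ip x a / ip a a) *: a.

Fact reflection_fun_is_linear (a : V) : linear (reflection_fun a).
Proof.
move=> k x y; rewrite /reflection_fun linearDl linearZl_LR /= scalerBr scalerA.
by rewrite addrACA -opprD -scalerDl; congr (_ - _ *: _); ring.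
Qed.

HB.instance Definition _ (a : V) :=
  GRing.isLinear.Build R V V *:%R (reflection_fun a)
    (reflection_fun_is_linear a).

Definition reflection (a : V) : 'End(V) := linfun (reflection_fun a).

End Reflection.

Section RootSystem.
Variables (R : realType) (V : vectType R) (ip : {dot V for idfun}).
Implicit Types (Delta Dp J I P : {fset V}) (D : int -> {fset V}) (w : 'End(V)).

Definition root_system Delta : Prop :=
  [/\ 0 \notin Delta, <<Delta>>%VS = fullv &
      forall a b, a \in Delta -> b \in Delta -> reflection ip a b \in Delta].

Definition crystallographic Delta : Prop :=
  forall a b, a \in Delta -> b \in Delta -> 2 * ip b a / ip a a \is a Num.int.

Definition reduced Delta : Prop :=
  forall a (c : R), a \in Delta -> c *: a \in Delta -> c = 1 \/ c = -1.

Definition irreducible Delta : Prop :=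
  Delta != fset0 /\
  forall A : {fset V}, A `<=` Delta ->
    (forall a b, a \in A -> b \in Delta `\` A -> ip a b = 0) ->
    A = fset0 \/ A = Delta.

(* The roots on the positive side of a hyperplane containing no root.  Phi need
   not span V, so the definition also applies to the subsystem Delta(0). *)
Definition positive_system (Phi P : {fset V}) : Prop :=
  exists v : V, (forall a, a \in Phi -> ip v a != 0) /\
                P = [fset a in Phi | 0 < ip v a].

Definition simple_roots Dp : {fset V} := Dp `\` [fset b + c | b in Dp, c in Dp].

(* Reflections are involutions, so the monoid they generate is a group. *)
Inductive weyl Delta : 'End(V) -> Prop :=
| weyl_id : weyl Delta \1%VF
| weyl_refl a w : a \in Delta -> weyl Delta w ->
    weyl Delta (reflection ip a \o w)%VF.

(* The last clause says that 0 has degree 0.  It follows from the third one for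
   an irreducible root system of rank at least 2, where every root occurs in a
   relation a + b = c between roots; in rank 1 the third clause is void. *)
Definition Zgrading Delta D : Prop :=
  [/\ forall a, a \in Delta <-> exists i, a \in D i,
      forall i j, i != j -> [disjoint D i & D j],
      forall i j a b, a \in D i -> b \in D j -> a + b \in Delta ->
        a + b \in D (i + j) &
      forall i a, a \in D i -> - a \in D (- i)].

Definition degree_ge D (m : int) (x : V) : Prop :=
  exists2 j : int, m <= j & x \in D j.

(* Dp0 stands for Delta(0)^+. *)
Definition compatible D Dp Dp0 : Prop :=
  positive_system (D 0) Dp0 /\
  forall a, a \in Dp <-> a \in Dp0 \/ degree_ge D 1 a.

Definition root_le Dp (mu g : V) : Prop :=
  exists c : V -> nat, g - mu = \sum_(a <- simple_roots Dp) a *+ c a.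

Definition lower_ideal D Dp I : Prop :=
  I `<=` D 1 /\
  forall g mu, g \in I -> mu \in D 1 -> root_le Dp mu g -> mu \in I.

Definition inversions Dp w : {fset V} := [fset g in Dp | - w g \in Dp].

(* iter_sum Delta J k is J^(k+1). *)
Fixpoint iter_sum Delta J (k : nat) : {fset V} :=
  if k is k'.+1 then [fset x + y | x in J, y in iter_sum Delta J k'] `&` Delta
  else J.

Definition sum_closure Delta J (g : V) : Prop :=
  exists k, g \in iter_sum Delta J k.

Definition W0 Delta Dp Dp0 w : Prop :=
  weyl Delta w /\ forall a, a \in Dp0 -> w a \in Dp.

Definition is_wmin Delta Dp I w : Prop :=
  unique (fun u => weyl Delta u /\
    forall g, g \in inversions Dp u <-> sum_closure Delta I g) w.

Definition W0min Delta D Dp w : Prop :=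
  exists2 I, lower_ideal D Dp I & is_wmin Delta Dp I w.

End RootSystem.

(* Main.v *)
(* If N(w) = <I> and w^-1(alpha) had degree at most -2 for a simple root alpha, then
   the inversion -w^-1(alpha) would be a sum of two inversions, so alpha would be a
   sum of two positive roots.

   Conversely, put I = N(w) & Delta(1).  To see that an inversion g lies in <I>, use
   induction on the height of b = -w(g).  If b is simple, then g has degree 1.
   Otherwise b = b1 + b2 with b1, b2 positive, and g = g1 + g2 with b_k = -w(g_k).
   If both degrees are positive, then g1, g2 are in <I>, which is closed under those
   sums that are roots.  If, say, g2 has degree at most 0, then g1 is in <I>, and <I>
   is stable under subtracting a root c = -g2 of nonnegative degree with w(c)
   positive, provided the result is a root of positive degree.  Both stability
   properties follow from the fact that if a, b, c, a + b and a + b + c are roots,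
   then a + c or b + c is a root or 0. *)

Require Import Defs.
From HB Require Import structures.
From mathcomp Require Import all_boot all_order all_algebra finmap reals.
From mathcomp Require Import zify lra ring.

Set Implicit Arguments.
Unset Strict Implicit.
Unset Printing Implicit Defensive.

Import Order.TTheory GRing.Theory Num.Theory.
Local Open Scope fset_scope.
Local Open Scope ring_scope.

(** Repeating each [a] exactly [c a] times permits induction on the number of summands. *)
Lemma sum_multiples (V : zmodType) (s : seq V) (c : V -> nat) :
  exists2 t, {subset t <= s} & \sum_(a <- s) a *+ c a = \sum_(a <- t) a.
Proof.
elim: s => [|a s [t ts sE]]; first by exists [::]; rewrite ?big_nil.
exists (nseq (c a) a ++ t) => [b|].
  by rewrite mem_cat mem_nseq inE => /orP[/andP[_ ->]|/ts->]; rewrite ?orbT.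
by rewrite big_cons big_cat big_nseq -Monoid.iteropE /= sE.
Qed.

Lemma subset_cons (T : eqType) (A : {pred T}) (x : T) (s : seq T) :
  {subset x :: s <= A} -> x \in A /\ {subset s <= A}.
Proof. by move/allP => /= /andP[xA /allP]. Qed.

(** * Inner products, reflections and products of reflections *)

Section DotProduct.
Variables (R : realType) (V : vectType R) (ip : {dot V for idfun}).
Implicit Types (a b c x y : V) (s : seq V) (f : 'End(V)).

Lemma dotC x y : ip x y = ip y x.
Proof. by rewrite (hermC ip) expr0 mul1r. Qed.

Lemma dotDl x y z : ip (x + y) z = ip x z + ip y z.
Proof. exact: linearDl. Qed.

Lemma dotDr x y z : ip z (x + y) = ip z x + ip z y.
Proof. exact: linearDr. Qed.

Lemma dotNl x z : ip (- x) z = - ip x z.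
Proof. exact: linearNl. Qed.

Lemma dotNr x z : ip z (- x) = - ip z x.
Proof. exact: linearNr. Qed.

Lemma dotZl k x z : ip (k *: x) z = k * ip x z.
Proof. exact: linearZl_LR. Qed.

Lemma dotZr k x z : ip z (k *: x) = k * ip z x.
Proof. by rewrite dotC dotZl dotC. Qed.

Lemma dot0r z : ip z 0 = 0.
Proof. exact: linear0r. Qed.

Definition dotE := (dotDl, dotDr, dotNl, dotNr, dotZl, dotZr).

Lemma dot_gt0 x : x != 0 -> 0 < ip x x.
Proof. exact: neq0_dnorm_gt0. Qed.

Lemma dot_sum_gt0 x s : 0 < ip x (\sum_(a <- s) a) ->
  exists2 a, a \in s & 0 < ip x a.
Proof.
elim: s => [|a s IHs]; first by rewrite big_nil dot0r ltxx.
rewrite big_cons dotDr; have [a_gt0 _|a_le0 sum_gt0] := ltP 0 (ip x a).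
  by exists a; rewrite ?mem_head.
have [|b bs b_gt0] := IHs; first by lra.
by exists b; rewrite // inE bs orbT.
Qed.

Lemma reflectionE a x : reflection ip a x = x - (2 * ip x a / ip a a) *: a.
Proof. by rewrite lfunE. Qed.

Lemma reflection_dot a x y :
  ip (reflection ip a x) (reflection ip a y) = ip x y.
Proof.
have [->|a_neq0] := eqVneq a 0; first by rewrite !reflectionE !scaler0 !subr0.
have := dot_gt0 a_neq0; rewrite !reflectionE !dotE (dotC a y) => /lt0r_neq0 aa.
by field.
Qed.

Lemma reflectionK a : involutive (reflection ip a).
Proof.
move=> x; have [->|a_neq0] := eqVneq a 0.
  by rewrite !reflectionE !scaler0 !subr0.
have /lt0r_neq0 aa := dot_gt0 a_neq0.
rewrite !reflectionE !dotE -addrA -opprD -scalerDl.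
suff -> : 2 * ip x a / ip a a +
    2 * (ip x a - 2 * ip x a / ip a a * ip a a) / ip a a = 0.
  by rewrite scale0r subr0.
by field.
Qed.

Lemma reflectionN a x : reflection ip (- a) x = reflection ip a x.
Proof. by rewrite !reflectionE !dotE !opprK scalerN mulrN mulNr scaleNr opprK. Qed.

Lemma reflection_self a : a != 0 -> reflection ip a a = - a.
Proof.
move=> /dot_gt0/lt0r_neq0 aa; rewrite reflectionE mulfK //.
by rewrite scaler_nat mulr2n opprD addNKr.
Qed.

Definition isometry (f : V -> V) := forall x y, ip (f x) (f y) = ip x y.

Lemma isometry_reflection f a x : isometry f ->
  f (reflection ip a x) = reflection ip (f a) (f x).
Proof. by move=> f_iso; rewrite !reflectionE linearB linearZ !f_iso. Qed.

(** [^-1] is only a partial inverse in general; a trivial kernel makes it cancel [f] on both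
    sides. *)
Lemma isometry_lker0 f : isometry f -> lker f == 0%VS.
Proof.
move=> f_iso; apply/lker0P => x y fxy; apply/eqP; rewrite -subr_eq0.
apply/negPn/negP => /dot_gt0; rewrite -f_iso linearB /= fxy subrr.
by rewrite dot0r ltxx.
Qed.

(** A word of reflections, the head acting last; a list gives access to length, reversal and last
    letter. *)
Definition reflections s : 'End(V) :=
  foldr (fun a f => reflection ip a \o f)%VF \1%VF s.

Lemma reflections_cons a s x :
  reflections (a :: s) x = reflection ip a (reflections s x).
Proof. by rewrite /= comp_lfunE. Qed.

Lemma reflections_cat s t x :
  reflections (s ++ t) x = reflections s (reflections t x).
Proof.
elim: s => [|a s IHs]; first by rewrite id_lfunE.
by rewrite cat_cons !reflections_cons IHs.
Qed.

Lemma reflections_rev s x : reflections s (reflections (rev s) x) = x.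
Proof.
elim: s x => [|a s IHs] x; first by rewrite !id_lfunE.
rewrite rev_cons -cats1 reflections_cons reflections_cat IHs.
by rewrite reflections_cons id_lfunE reflectionK.
Qed.

Lemma reflections_isometry s : isometry (reflections s).
Proof.
elim: s => [|a s IHs] x y; first by rewrite !id_lfunE.
by rewrite !reflections_cons reflection_dot IHs.
Qed.

End DotProduct.

(** * Sums and differences of roots *)

Section RootSystem.
Variables (R : realType) (V : vectType R) (ip : {dot V for idfun}).
Variable Delta : {fset V}.
Hypothesis Delta_root : root_system ip Delta.
Hypothesis Delta_cryst : crystallographic ip Delta.
Implicit Types (a b c x y : V) (s : seq V) (f w u : 'End(V)).

Lemma root_neq0 a : a \in Delta -> a != 0.
Proof. by case: Delta_root => Delta0 _ _ aD; apply: contraNneq Delta0 => <-. Qed.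

Lemma root_reflection a b :
  a \in Delta -> b \in Delta -> reflection ip a b \in Delta.
Proof. by case: Delta_root => _ _; apply. Qed.

Lemma root_opp a : a \in Delta -> - a \in Delta.
Proof.
by move=> aD; rewrite -(reflection_self ip (root_neq0 aD)) root_reflection.
Qed.

Lemma rootN a : (- a \in Delta) = (a \in Delta).
Proof. by apply/idP/idP => /root_opp //; rewrite opprK. Qed.

(* One of the two positive Cartan integers of the pair is 1, since otherwise
   |a - b|^2 <= 0. *)
Lemma root_sub a b : a \in Delta -> b \in Delta -> 0 < ip a b -> a != b ->
  a - b \in Delta.
Proof.
move=> aD bD ab_gt0 neq_ab.
have aa := dot_gt0 ip (root_neq0 aD); have bb := dot_gt0 ip (root_neq0 bD).
have step p : p \is a Num.int -> 0 < p -> p = 1 \/ 2 <= p :> R.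
  move=> /intrP[n ->]; rewrite ltr0z => n_gt0.
  have [->|n_neq1] := eqVneq n 1; [by left | right].
  by rewrite -[2]/(2%:~R) ler_int; lia.
have [] := step _ (Delta_cryst bD aD); first by rewrite !divr_gt0 ?mulr_gt0.
  by move=> n1; have := root_reflection bD aD; rewrite reflectionE n1 scale1r.
have [] := step _ (Delta_cryst aD bD).
- by rewrite !divr_gt0 ?mulr_gt0 // dotC.
- move=> n1 _; have := root_reflection aD bD.
  by rewrite reflectionE n1 scale1r -rootN opprB.
rewrite !ler_pdivlMr // (dotC ip b a) => ge_a ge_b.
have := dot_gt0 ip (_ : a - b != 0); rewrite subr_eq0 => /(_ neq_ab).
rewrite !dotE (dotC ip b a); lra.
Qed.

Lemma root_add a b : a \in Delta -> b \in Delta -> ip a b < 0 ->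
  a + b = 0 \/ a + b \in Delta.
Proof.
move=> aD bD ab_lt0; have [->|neq] := eqVneq a (- b); first by left; rewrite addNr.
by right; rewrite -[b]opprK root_sub ?root_opp // dotNr oppr_gt0.
Qed.

(* Otherwise c makes no obtuse angle with a or b, while the root a + b + c makes
   no acute angle with a or b; these two facts contradict |a + b|^2 > 0. *)
Lemma root_add3 a b c : a \in Delta -> b \in Delta -> c \in Delta ->
    a + b \in Delta -> a + b + c \in Delta ->
  (a + c = 0 \/ a + c \in Delta) \/ (b + c = 0 \/ b + c \in Delta).
Proof.
move=> aD bD cD abD abcD.
have [/(root_add aD cD)|ac] := ltP (ip a c) 0; first by left.
have [/(root_add bD cD)|bc] := ltP (ip b c) 0; first by right.
have [/(root_add abcD (root_opp aD))|sa] := ltP (ip (a + b + c) (- a)) 0.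
  by rewrite addrAC [a + b]addrC addrK; right.
have [/(root_add abcD (root_opp bD))|sb] := ltP (ip (a + b + c) (- b)) 0.
  by rewrite [a + b + c - b]addrAC addrK; left.
exfalso; have := dot_gt0 ip (root_neq0 abD).
move: sa sb; rewrite !dotE (dotC ip b a) (dotC ip c a) (dotC ip c b); lra.
Qed.

(** * The action of the Weyl group on roots *)

Lemma weyl_reflections w : weyl ip Delta w ->
  exists2 s, {subset s <= Delta} & w = reflections ip s.
Proof.
elim=> [|a f aD _ [s sD ->]]; first by exists [::].
by exists (a :: s) => // b; rewrite inE => /predU1P[->|/sD].
Qed.

Lemma weyl_isometry w : weyl ip Delta w -> isometry ip w.
Proof. by move=> /weyl_reflections[s _ ->]; exact: reflections_isometry. Qed.

Lemma weylK w : weyl ip Delta w -> cancel w (w^-1)%VF.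
Proof. by move=> /weyl_isometry/isometry_lker0/lker0_lfunK. Qed.

Lemma weylVK w : weyl ip Delta w -> cancel (w^-1)%VF w.
Proof. by move=> /weyl_isometry/isometry_lker0/lker0_lfunVK. Qed.

Lemma reflections_root s a : {subset s <= Delta} -> a \in Delta ->
  reflections ip s a \in Delta.
Proof.
elim: s => [|b s IHs] sD aD; first by rewrite id_lfunE.
have [bD {}sD] := subset_cons sD.
by rewrite reflections_cons; exact: root_reflection (IHs sD aD).
Qed.

Lemma weyl_root w a : weyl ip Delta w -> a \in Delta -> w a \in Delta.
Proof. by move=> /weyl_reflections[s sD ->]; exact: reflections_root. Qed.

Lemma weylV w : weyl ip Delta w -> exists2 s, {subset s <= Delta} &
  (w^-1)%VF = reflections ip s.
Proof.
move=> w_weyl; have [s sD wE] := weyl_reflections w_weyl.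
exists (rev s) => [a|]; first by rewrite mem_rev => /sD.
apply/lfunP => x; rewrite -[RHS](weylK w_weyl); congr (_ _).
by rewrite wE reflections_rev.
Qed.

Lemma weylV_root w a : weyl ip Delta w -> a \in Delta -> (w^-1)%VF a \in Delta.
Proof. by move=> /weylV[s sD ->]; exact: reflections_root. Qed.

Lemma inversionsE (P : {fset V}) f a :
  (a \in inversions P f) = (a \in P) && (- f a \in P).
Proof. by rewrite !inE. Qed.

(** * Positive systems and simple roots *)

Section PositiveRoots.
Hypothesis Delta_red : reduced Delta.
Variable v : V.
Hypothesis v_regular : forall a, a \in Delta -> ip v a != 0.
Let Dp : {fset V} := [fset a in Delta | 0 < ip v a].
Let Pi : {fset V} := simple_roots Dp.

Lemma posE a : (a \in Dp) = (a \in Delta) && (0 < ip v a).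
Proof. by rewrite !inE. Qed.

Lemma pos_root a : a \in Dp -> a \in Delta.
Proof. by rewrite posE => /andP[]. Qed.

Lemma pos_gt0 a : a \in Dp -> 0 < ip v a.
Proof. by rewrite posE => /andP[]. Qed.

Lemma pos_or_neg a : a \in Delta -> a \in Dp \/ - a \in Dp.
Proof.
move=> aD; rewrite !posE rootN aD dotNr oppr_gt0 /=.
by have := v_regular aD; rewrite neq_lt => /orP[]; [right | left].
Qed.

Lemma pos_opp a : a \in Dp -> - a \notin Dp.
Proof.
by move=> /pos_gt0 a_gt0; apply/negP => /pos_gt0; rewrite dotNr; lra.
Qed.

Lemma pos_add a b : a \in Dp -> b \in Dp -> a + b \in Delta -> a + b \in Dp.
Proof.
by move=> /pos_gt0 a_gt0 /pos_gt0 b_gt0 abD; rewrite posE abD dotDr addr_gt0.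
Qed.

(** The real number [ip v a] serves as height; as [Dp] is finite, counting the positive roots of
    smaller value makes the induction well founded. *)
Lemma pos_ind (P : V -> Prop) :
    (forall a, a \in Dp -> (forall b, b \in Dp -> ip v b < ip v a -> P b) -> P a) ->
  forall a, a \in Dp -> P a.
Proof.
move=> IH a; have [n] := ubnP #|` [fset b in Dp | ip v b < ip v a]|.
elim: n a => // n IHn a lt_n aP; apply: IH => // b bP lt_ba.
apply: IHn => //; rewrite ltnS in lt_n; apply: leq_trans lt_n.
apply: fproper_ltn_card; rewrite fproperE; apply/andP; split.
  by apply/fsubsetP => c; rewrite !inE /= => /andP[-> /lt_trans->].
by apply/fsubsetPn; exists b; rewrite !inE /= ?ltxx ?andbF // -posE bP.
Qed.

Lemma simple_pos a : a \in Pi -> a \in Dp.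
Proof. by rewrite inE => /andP[]. Qed.

Lemma simple_indecomposable a b c : a \in Pi -> b \in Dp -> c \in Dp -> a != b + c.
Proof.
rewrite inE => /andP[aN _] bP cP; apply: contraNneq aN => ->.
by apply/imfset2P; exists b => //; exists c.
Qed.

Lemma simple_or_sum a : a \in Dp ->
  a \in Pi \/ exists b c, [/\ b \in Dp, c \in Dp & a = b + c].
Proof.
move=> aP; have [|/negPn] := boolP (a \notin [fset b + c | b in Dp, c in Dp]).
  by left; rewrite inE aP andbT.
by case/imfset2P => b bP [c cP ->]; right; exists b, c.
Qed.

Lemma pos_simple_sum a : a \in Dp ->
  exists2 s, {subset s <= Pi} & a = \sum_(b <- s) b.
Proof.
move: a; apply: pos_ind => a /simple_or_sum[aPi _|[b [c [bP cP ->]]] IH].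
  by exists [:: a]; rewrite ?big_seq1 // => b; rewrite inE => /eqP->.
have [||s sPi ->] := IH b; rewrite ?dotDr ?ltrDl ?pos_gt0 //.
have [||t tPi ->] := IH c; rewrite ?dotDr ?ltrDr ?pos_gt0 //.
exists (s ++ t); last by rewrite big_cat.
by move=> d; rewrite mem_cat => /orP[/sPi|/tPi].
Qed.

(** If [b - a] were positive, [b = a + (b - a)] would decompose a simple root. *)
Lemma pos_sub_simple a b : a \in Dp -> b \in Pi -> 0 < ip a b -> a != b ->
  a - b \in Dp.
Proof.
move=> aP bPi ab_gt0 neq_ab.
have abD := root_sub (pos_root aP) (pos_root (simple_pos bPi)) ab_gt0 neq_ab.
have [//|baP] := pos_or_neg abD.
have := simple_indecomposable bPi aP baP.
by rewrite opprB addrCA subrr addr0 eqxx.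
Qed.

(* One of b, c makes an acute angle with a, hence equals a or stays positive after
   subtracting a; by reducedness no other multiple of a is a positive root. *)
Lemma pos_sum_simple a b c (n : nat) : a \in Pi -> b \in Dp -> c \in Dp ->
  b + c = a *+ n -> b = a.
Proof.
move=> aPi; have aP := simple_pos aPi; have aD := pos_root aP.
have a0 := root_neq0 aD; have v_a := pos_gt0 aP.
(* Both equalities are proved at once, so that [b] and [c] can be exchanged. *)
suff: forall b c, b \in Dp -> c \in Dp -> b + c = a *+ n -> b = a /\ c = a.
  by move=> H bP cP /(H b c bP cP)[].
have multiple d (m : nat) : d \in Dp -> d = a *+ m -> d = a.
  move=> dP dE; have := pos_root dP; rewrite dE -scaler_nat.
  case/(Delta_red aD) => m1; first by rewrite m1 scale1r.
  by exfalso; have := pos_gt0 dP; rewrite dE -scaler_nat m1 scaleN1r dotNr; lra.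
have no_double d : d \in Dp -> d - a = a -> False.
  move=> dP /(canRL (subrK _)) dE.
  have /(_ 2%N dP) dd := multiple d _; have : d - a = 0.
    by rewrite dd ?subrr // dE mulr2n.
  by rewrite dE addrK; apply/eqP.
elim: n {b c} => [|n IHn] b c bP cP.
  move/(congr1 (ip v)); rewrite mulr0n dot0r dotDr => bc.
  by exfalso; have := pos_gt0 bP; have := pos_gt0 cP; lra.
wlog ba : b c bP cP / 0 < ip b a => [wl bc|].
  have [/(wl b c bP cP)|ba] := ltP 0 (ip b a); first exact.
  have [ca|ca] := ltP 0 (ip c a).
    by have [] := wl c b cP bP ca; rewrite 1?addrC.
  exfalso; have := congr1 (ip a) bc; rewrite -scaler_nat dotDr dotZr.
  have : 0 < n.+1%:R * ip a a by rewrite mulr_gt0 // dot_gt0.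
  by rewrite (dotC ip a b) (dotC ip a c); lra.
have [->|neq_ba] := eqVneq b a => bc.
  split=> //; apply: (@multiple c n) => //.
  by move: bc; rewrite mulrS => /addrI.
(* The induction hypothesis gives [b - a = a], which [no_double] excludes. *)
have [|bE _] := IHn (b - a) c (pos_sub_simple bP aPi ba neq_ba) cP.
  by rewrite addrAC bc mulrSr addrK.
by case: (no_double b).
Qed.

(** Write the image as b - n a. If it were negative, b and its opposite would be positive roots with
    sum n a, so b = a when n >= 0; when n < 0 the image is visibly positive. *)
Lemma pos_simple_reflection a b : a \in Pi -> b \in Dp -> b != a ->
  reflection ip a b \in Dp.
Proof.
move=> aPi bP neq_ba; have aP := simple_pos aPi.
have rD : reflection ip a b \in Delta by rewrite root_reflection ?pos_root.
have [//|rN] := pos_or_neg rD.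
have aa := dot_gt0 ip (root_neq0 (pos_root aP)).
have /intrP[n nE] := Delta_cryst (pos_root aP) (pos_root bP).
move: rD rN; rewrite reflectionE nE scaler_int => rD rN.
case: n => [n|n] in nE rD rN *.
  have := @pos_sum_simple a b _ n aPi bP rN; rewrite opprB addrCA subrr addr0.
  by move/(_ erefl)/eqP; rewrite (negPf neq_ba).
rewrite posE rD NegzE mulrNz opprK dotDr -[_ *~ _]scaler_int dotZr.
by rewrite addr_gt0 ?mulr_gt0 ?pos_gt0 ?ltr0n.
Qed.

(* Induction on the height of b: a non-simple positive root b makes an acute angle
   with some simple root a, and s_b = s_a s_(s_a b) s_a. *)
Lemma reflection_simple b : b \in Delta ->
  exists2 s, {subset s <= Pi} & reflection ip b =1 reflections ip s.
Proof.
wlog: b / b \in Dp => [wl bD|bP _].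
  have [/wl|/wl] := pos_or_neg bD; first exact.
  rewrite rootN => /(_ bD)[s sPi sE].
  by exists s => // x; rewrite -reflectionN sE.
move: b bP; apply: pos_ind => b bP IH.
have [s sPi bE] := pos_simple_sum bP.
have := dot_gt0 ip (root_neq0 (pos_root bP)); rewrite {2}bE.
case/dot_sum_gt0 => a /sPi aPi ba_gt0.
have [->|neq_ba] := eqVneq b a.
  exists [:: a] => [c|x]; first by rewrite inE => /eqP->.
  by rewrite reflections_cons id_lfunE.
have aP := simple_pos aPi; have aa := dot_gt0 ip (root_neq0 (pos_root aP)).
have [||t tPi tE] := IH (reflection ip a b); first exact: pos_simple_reflection.
  rewrite reflectionE dotDr dotNr dotZr gtrBl.
  by rewrite !mulr_gt0 ?invr_gt0 ?pos_gt0.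
exists (a :: rcons t a) => [c|x].
  by rewrite inE mem_rcons inE => /or3P[/eqP->|/eqP->|/tPi].
rewrite reflections_cons -cats1 reflections_cat -tE reflections_cons id_lfunE.
by rewrite isometry_reflection ?reflectionK //; exact: reflection_dot.
Qed.

(** * Words in simple reflections and inversion sets *)

Lemma weyl_simple w : weyl ip Delta w ->
  exists2 s, {subset s <= Pi} & w = reflections ip s.
Proof.
elim=> [|a f aD _ [t tPi ->]]; first by exists [::].
have [s sPi sE] := reflection_simple aD; exists (s ++ t) => [b|].
  by rewrite mem_cat => /orP[/sPi|/tPi].
by apply/lfunP => x; rewrite reflections_cat -sE comp_lfunE.
Qed.

(** Read from the right, some letter [b] is the first to make the image of [a] negative. A simple
    reflection makes no positive root negative but its own, so the letters to the right of [b] send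
    [a] to [b], and the reflections in [b] and [a] cancel. *)
Lemma exchange a s : a \in Pi -> {subset s <= Pi} -> - reflections ip s a \in Dp ->
  exists t, [/\ {subset t <= Pi}, size s = (size t).+1 &
    reflections ip (rcons s a) =1 reflections ip t].
Proof.
move=> aPi; elim: s => [|b s IHs] sPi.
  by rewrite id_lfunE => /(negP (pos_opp (simple_pos aPi))).
have [bPi {}sPi] := subset_cons sPi.
rewrite reflections_cons -linearN /= => baP.
have sD : {subset s <= Delta} by move=> c /sPi/simple_pos/pos_root.
have saD := reflections_root sD (pos_root (simple_pos aPi)).
have [saP|/(IHs sPi)[t [tPi st tE]]] := pos_or_neg saD; last first.
  exists (b :: t); rewrite /= st; split=> // [c|x].
    by rewrite inE => /predU1P[->|/tPi].
  by rewrite [LHS]reflections_cons [RHS]reflections_cons tE.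
exists s; split=> // x; rewrite comp_lfunE -cats1 reflections_cat.
rewrite reflections_cons id_lfunE isometry_reflection; last first.
  exact: reflections_isometry.
have [<-|neq] := eqVneq (reflections ip s a) b; first by rewrite reflectionK.
have /negP[] := pos_opp (pos_simple_reflection bPi saP neq).
by rewrite -linearN.
Qed.

(** If a nonempty word ends in [a], its other letters send [a] to a negative root, and [exchange]
    shortens the word by two letters. *)
Lemma weyl_pos_id w : weyl ip Delta w -> (forall a, a \in Dp -> w a \in Dp) ->
  w =1 id.
Proof.
move=> /weyl_simple[s sPi ->{w}].
have [n] := ubnP (size s); elim: n s sPi => // n IHn s.
case/lastP: s => [|s a] sPi sn sP x; first by rewrite id_lfunE.
have aPi : a \in Pi by rewrite sPi // mem_rcons mem_head.
have aP := simple_pos aPi.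
have [||t [tPi st tE]] := @exchange a s aPi.
- by move=> c cs; rewrite sPi // mem_rcons inE cs orbT.
- have := sP a aP; rewrite -cats1 reflections_cat reflections_cons id_lfunE.
  by rewrite reflection_self ?linearN // root_neq0 ?pos_root.
rewrite tE; apply: IHn => // [|b /sP]; last by rewrite tE.
by rewrite size_rcons st in sn; lia.
Qed.

(** The product of [u] and [w^-1] preserves [Dp], since [u] and [w] give every root the same sign;
    hence it is the identity. *)
Lemma inversions_inj u w : weyl ip Delta u -> weyl ip Delta w ->
  inversions Dp u = inversions Dp w -> u = w.
Proof.
move=> u_weyl w_weyl uw; apply/lfunP => x.
have [s sD sE] := weylV w_weyl.
have [t tD tE] := weyl_reflections u_weyl.
have weyl_refl r : {subset r <= Delta} -> weyl ip Delta (reflections ip r).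
  elim: r => [|a r IHr] rD; first exact: weyl_id.
  by have [aD /IHr] := subset_cons rD; exact: weyl_refl.
have ts : {subset t ++ s <= Delta} by move=> a; rewrite mem_cat => /orP[/tD|/sD].
have tsE y : reflections ip (t ++ s) y = u ((w^-1)%VF y).
  by rewrite reflections_cat tE sE.
have := weyl_pos_id (weyl_refl _ ts) _ (w x); rewrite tsE weylK //; apply.
move=> a aP; have aD := pos_root aP; rewrite tsE.
have vD := weylV_root w_weyl aD.
have := erefl (w ((w^-1)%VF a) \in Dp); rewrite {2}weylVK // aP.
move: (_^-1%VF a) vD => b bD wbP.
have ubD := weyl_root u_weyl bD.
have inv f c : c \in Dp -> (c \in inversions Dp f) = (- f c \in Dp).
  by move=> cP; rewrite inversionsE cP.
have [bP|bP] := pos_or_neg bD.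
  have [//|ubP] := pos_or_neg ubD.
  by have := inv u b bP; rewrite uw inv // ubP (negPf (pos_opp wbP)).
by have := inv w _ bP; rewrite -uw inv // !linearN !opprK => ->.
Qed.

(** * Gradings and closures of sets of roots of degree 1 *)

Section Grading.
Variables (D : int -> {fset V}) (Dp0 : {fset V}).
Hypothesis D_grading : Zgrading Delta D.
Hypothesis Dp_compat : compatible ip D Dp Dp0.

Lemma degree_root i a : a \in D i -> a \in Delta.
Proof. by case: D_grading => DE _ _ _ aD; apply/DE; exists i. Qed.

Lemma root_degree a : a \in Delta -> exists i, a \in D i.
Proof. by case: D_grading => DE _ _ _ /DE. Qed.

Lemma degree_unique i j a : a \in D i -> a \in D j -> i = j.
Proof.
case: D_grading => _ Ddisj _ _ ai aj; have [//|/Ddisj/fdisjointP] := eqVneq i j.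
by move=> /(_ a ai); rewrite aj.
Qed.

Lemma degree_add i j a b : a \in D i -> b \in D j -> a + b \in Delta ->
  a + b \in D (i + j).
Proof. by case: D_grading => _ _ + _; apply. Qed.

Lemma degree_opp i a : a \in D i -> - a \in D (- i).
Proof. by case: D_grading => _ _ _; apply. Qed.

Lemma degree_pos i a : 1 <= i -> a \in D i -> a \in Dp.
Proof. by move=> i1 ai; case: Dp_compat => _ DpE; apply/DpE; right; exists i. Qed.

Lemma pos_degree_ge1 a : a \in Dp -> a \notin Dp0 -> exists2 i, 1 <= i & a \in D i.
Proof. by case: Dp_compat => _ DpE /DpE[->|]. Qed.

Lemma pos0_sub a : a \in Dp0 -> a \in D 0 /\ a \in Dp.
Proof.
case: Dp_compat => -[u [_ Dp0E]] DpE aP0; split; last by apply/DpE; left.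
by move: aP0; rewrite Dp0E !inE => /andP[].
Qed.

Lemma pos_degree_ge0 i a : a \in Dp -> a \in D i -> 0 <= i.
Proof.
move=> aP ai; have [/pos0_sub[a0 _]|/(pos_degree_ge1 aP)[j j1 aj]] :=
  boolP (a \in Dp0).
  by rewrite (degree_unique ai a0).
by rewrite (degree_unique ai aj) (le_trans _ j1).
Qed.

Lemma pos0E a : a \in Dp -> a \in D 0 -> a \in Dp0.
Proof.
move=> aP a0; apply/negPn/negP => /(pos_degree_ge1 aP)[j + aj].
by rewrite -(degree_unique a0 aj).
Qed.

(** The closure grows by one generator at a time, so its stability under sums of two arbitrary
    elements is not immediate; [closure_add] supplies it for [I]. *)
Lemma sum_closure_ind (J : {fset V}) (P : V -> Prop) :
    (forall a, a \in J -> P a) ->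
    (forall a b, a \in J -> sum_closure Delta J b -> P b -> a + b \in Delta ->
      P (a + b)) ->
  forall a, sum_closure Delta J a -> P a.
Proof.
move=> PJ PD a [k]; elim: k a => [|k IHk] a /=; first exact: PJ.
rewrite in_fsetI => /andP[/imfset2P[b bJ [c ck ->]] bcD].
by apply: PD => //; [exists k | exact: IHk].
Qed.

Lemma sum_closure_gen (J : {fset V}) a : a \in J -> sum_closure Delta J a.
Proof. by exists 0%N. Qed.

Lemma sum_closure_cons (J : {fset V}) a b : a \in J -> sum_closure Delta J b ->
  a + b \in Delta -> sum_closure Delta J (a + b).
Proof.
move=> aJ [k bk] abD; exists k.+1; rewrite /= in_fsetI abD andbT.
by apply/imfset2P; exists a => //; exists b.
Qed.

Lemma sum_closure_degree (J : {fset V}) a : J `<=` D 1 ->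
  sum_closure Delta J a -> exists2 i, 1 <= i & a \in D i.
Proof.
move=> /fsubsetP JD; move: a; apply: sum_closure_ind => [a /JD|a b /JD a1 _].
  by exists 1.
case=> i i1 bi abD; exists (1 + i); last exact: degree_add.
by rewrite lerDl (le_trans _ i1).
Qed.

(** * Inversions of a Weyl group element and stability of <I> *)

Section WeylElement.
Variable w : 'End(V).
Hypothesis w_weyl : weyl ip Delta w.

(** The only possible ideal: sums of k elements of degree 1 have degree k, so <J> meets Delta(1) in
    J. *)
Let I : {fset V} := inversions Dp w `&` D 1.

Lemma inversion1E a : (a \in I) = (- w a \in Dp) && (a \in D 1).
Proof.
rewrite in_fsetI inversionsE; have [a1|] := boolP (a \in D 1); last by rewrite !andbF.
by rewrite (degree_pos _ a1).
Qed.

Lemma sum_closure_inversion (J : {fset V}) a : J `<=` inversions Dp w ->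
  sum_closure Delta J a -> a \in inversions Dp w.
Proof.
move=> /fsubsetP JN; move: a; apply: sum_closure_ind => [a /JN//|a b /JN].
rewrite !inversionsE => /andP[aP waP] _ /andP[bP wbP] abD.
rewrite pos_add //= linearD opprD pos_add // -opprD -linearD /= rootN.
exact: weyl_root.
Qed.

Let II := sum_closure Delta I.

Lemma closure_opp a : II a -> - w a \in Dp.
Proof.
move=> /(sum_closure_inversion (fsubsetIl _ _)).
by rewrite inversionsE => /andP[].
Qed.

Lemma closure_root a : II a -> a \in Delta.
Proof.
by case/(sum_closure_degree (fsubsetIr _ _)) => i _; exact: degree_root.
Qed.

(** Induction on the number of generators. In [a + b - c] with [a] in [I], [root_add3] makes [a - c]
    or [b - c] a root, and [c] is absorbed there. *)
Lemma closure_sub a c (i j : int) : II a -> 0 <= i -> c \in D i -> w c \in Dp ->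
  1 <= j -> a - c \in D j -> II (a - c).
Proof.
move=> IIa; move: a IIa c i j; apply: sum_closure_ind.
  move=> a aI c i j i0 ci wcP j1 acj; apply: sum_closure_gen.
  move: aI; rewrite !inversion1E => /andP[waP a1].
  have := degree_unique acj (degree_add a1 (degree_opp ci) (degree_root acj)).
  (* Here j = 1 - i, so the bounds on i and j force j = 1. *)
  move=> jE; rewrite (_ : j = 1) in acj; last by clear - i0 j1 jE; lia.
  rewrite acj andbT linearB opprB addrC pos_add // addrC -opprB -linearB rootN.
  exact: weyl_root (degree_root acj).
move=> a b aI IIb IHb abD c i j i0 ci wcP j1 acj.
have waP := closure_opp (sum_closure_gen aI); have wbP := closure_opp IIb.
have abcD := degree_root acj; have cD := degree_root ci.
have := aI; rewrite inversion1E => /andP[_ a1].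
have aD := degree_root a1; have bD := closure_root IIb.
have [j_1|j_neq1] := eqVneq j 1.
  apply: sum_closure_gen; rewrite inversion1E -j_1 acj andbT.
  rewrite linearB opprB addrC pos_add //.
    by apply: closure_opp; apply: sum_closure_cons.
  by rewrite addrC -opprB -linearB rootN weyl_root.
(* [w] makes [c] positive but [a] and [b] negative, so neither difference vanishes. *)
have neq d : - w d \in Dp -> d - c = 0 -> False.
  by move=> wdP /subr0_eq dc; have := pos_opp wcP; rewrite -dc wdP.
have [[/neq//|acD]|[/neq//|bcD]] := root_add3 aD bD (root_opp cD) abD abcD.
  have ac_deg := degree_add a1 (degree_opp ci) acD.
  have wacP : w (c - a) \in Dp.
    rewrite linearB pos_add // -linearB; apply: weyl_root => //.
    by rewrite -rootN opprB.
  (* [a - c] has degree 1 - i. For i = 0 it lies in [I]; otherwise [c - a] has degree i - 1 >= 0 and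
     takes the place of [c] in the induction hypothesis for [b]. *)
  have [i_0|i_neq0] := eqVneq i 0.
    rewrite addrAC; apply: sum_closure_cons; rewrite // 1?addrAC //.
    by rewrite inversion1E -linearN opprB wacP /=; move: ac_deg; rewrite i_0.
  have ca_deg : c - a \in D (i - 1).
    by rewrite -[c - a]opprB -[i - 1]opprB; exact: degree_opp.
  have abcE : b - (c - a) = a + b - c by rewrite opprB addrC addrAC.
  rewrite -abcE; rewrite -abcE in acj.
  have i1_ge0 : 0 <= i - 1 by clear - i0 i_neq0; lia.
  exact: IHb i1_ge0 ca_deg wacP j1 acj.
have [k bck] := root_degree bcD.
rewrite -addrA in acj abcD *; apply: sum_closure_cons => //.
(* The degree of [b - c] is j - 1, still at least 1 because j is not 1. *)
have jE := degree_unique acj (degree_add a1 bck abcD).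
have k1 : 1 <= k by clear - jE j1 j_neq1; lia.
exact: IHb i0 ci wcP k1 bck.
Qed.

(** Induction on the first summand: [a + c + b] with [a] in [I] regroups as [c + (a + b)] or
    [a + (c + b)], whichever bracket [root_add3] makes a root. *)
Lemma closure_add a b : II a -> II b -> a + b \in Delta -> II (a + b).
Proof.
move=> IIa; move: a IIa b; apply: sum_closure_ind => [a aI b IIb abD|].
  exact: sum_closure_cons.
move=> a c aI IIc IHc acD b IIb acbD.
have wbP := closure_opp IIb.
have neq d : II d -> d + b = 0 -> False.
  move=> /closure_opp + /eqP; rewrite addr_eq0 => /[swap] /eqP->.
  by rewrite linearN /= (negPf (pos_opp wbP)).
have IIa := sum_closure_gen aI.
have := root_add3 (closure_root IIa) (closure_root IIc) (closure_root IIb) acD acbD.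
case=> [[/(neq _ IIa)//|abD]|[/(neq _ IIc)//|cbD]].
  rewrite -addrA [c + b]addrC addrA addrC in acbD *.
  by apply: IHc; [exact: sum_closure_cons | done].
by rewrite -addrA in acbD *; apply: sum_closure_cons => //; exact: IHc.
Qed.

(** * Elements satisfying the degree condition on simple roots *)

Hypothesis w_W0 : forall a, a \in Dp0 -> w a \in Dp.
Hypothesis w_simple : forall a, a \in Pi -> degree_ge D (-1) ((w^-1)%VF a).

(** Positive roots of degree 0 lie in [Dp0] and stay positive under [w]. *)
Lemma inversion_degree a : a \in inversions Dp w -> exists2 i, 1 <= i & a \in D i.
Proof.
rewrite inversionsE => /andP[aP waP]; apply: pos_degree_ge1 aP _.
by apply/negP => /w_W0/pos_opp; rewrite waP.
Qed.

Lemma inversions_closure a : a \in inversions Dp w -> II a.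
Proof.
have [b bE] : exists b, b = - w a by exists (- w a).
move=> aN; have := aN; rewrite inversionsE => /andP[_]; rewrite -bE => bP.
move: b bP a bE aN; apply: pos_ind => b bP IH a bE aN.
have aE : a = - (w^-1)%VF b by rewrite bE linearN /= weylK ?opprK.
have [i i1 ai] := inversion_degree aN.
have [/w_simple[j j1 bj]|[b1 [b2 [b1P b2P bD]]]] := simple_or_sum bP.
  (* For simple [b], [w_simple] bounds the degree of [a] above by 1. *)
  apply: sum_closure_gen; rewrite in_fsetI aN /=.
  have := degree_opp bj; rewrite -aE => /(degree_unique ai) ij.
  by rewrite (_ : 1 = i) //; clear - ij i1 j1; lia.
pose a1 := - (w^-1)%VF b1; pose a2 := - (w^-1)%VF b2.
have a12 : a = a1 + a2 by rewrite aE bD linearD opprD.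
have wa c : - w (- (w^-1)%VF c) = c by rewrite linearN /= weylVK ?opprK.
have a1D : a1 \in Delta by rewrite rootN weylV_root // pos_root.
have a2D : a2 \in Delta by rewrite rootN weylV_root // pos_root.
have [i1' a1i] := root_degree a1D; have [i2' a2i] := root_degree a2D.
have aD := degree_root ai; rewrite a12 in ai aD *.
have iE := degree_unique ai (degree_add a1i a2i aD).
have lt1 : ip v b1 < ip v b by rewrite bD dotDr ltrDl pos_gt0.
have lt2 : ip v b2 < ip v b by rewrite bD dotDr ltrDr pos_gt0.
have II1 : 1 <= i1' -> II a1.
  move=> i1'1; apply: (IH b1) => //; rewrite ?inversionsE wa // b1P andbT.
  exact: degree_pos a1i.
have II2 : 1 <= i2' -> II a2.
  move=> i2'1; apply: (IH b2) => //; rewrite ?inversionsE wa // b2P andbT.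
  exact: degree_pos a2i.
have wN c : w (- - (w^-1)%VF c) = c by rewrite opprK weylVK.
have [i1'1|i1'0] := leP 1 i1'; last first.
  (* Subtract [- a1] from [a2]: it has nonnegative degree and [w] sends it to the positive root
     [b1]. *)
  rewrite addrC -[a1]opprK; apply: (@closure_sub _ _ (- i1') i).
  - by apply: II2; clear - iE i1 i1'0; lia.
  - by clear - i1'0; lia.
  - exact: degree_opp.
  - by rewrite wN.
  - by [].
  - by rewrite opprK addrC.
have [i2'1|i2'0] := leP 1 i2'; first by apply: closure_add => //; auto.
rewrite -[a2]opprK; apply: (@closure_sub _ _ (- i2') i).
- exact: II1.
- by clear - i2'0; lia.
- exact: degree_opp.
- by rewrite wN.
- by [].
- by rewrite opprK.
Qed.

(* Along a chain of roots from a to b adding one simple root at a time, degrees do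
   not decrease, so simple roots of positive degree occur only if the degree
   increases. *)
Lemma root_le_degree a b : a \in Dp -> b \in Dp -> root_le Dp a b ->
  exists i j, [/\ a \in D i, b \in D j, i <= j &
    i = j -> w a \in Dp -> w b \in Dp].
Proof.
move=> aP bP [c]; have [s sPi ->] := sum_multiples (simple_roots Dp) c.
have [n sn] := ubnP (size s); elim: n s sn sPi a b aP bP {c} => // n IHn s sn sPi.
move=> a b aP bP abE.
have [->|neq_ba] := eqVneq b a.
  by have [i ai] := root_degree (pos_root aP); exists i, i.
(* Some listed simple root [d] has positive product with [b - a], so it is acute to [b] or obtuse to
   [a]; the chain is shortened by passing to [b - d] or to [a + d]. *)
have := @dot_gt0 _ _ ip (b - a); rewrite subr_eq0 {2}abE => /(_ neq_ba).
case/dot_sum_gt0 => d ds d_gt0.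
have dPi := sPi d ds; have dP := simple_pos dPi.
have [k dk] := root_degree (pos_root dP); have k0 := pos_degree_ge0 dP dk.
have wd : k = 0 -> w d \in Dp by move=> k_0; apply/w_W0/pos0E; rewrite // -k_0.
have abdE : b - a = d + \sum_(e <- rem d s) e.
  by rewrite abE (perm_big _ (perm_to_rem ds)) big_cons.
have {}sPi : {subset rem d s <= Pi} by move=> e /mem_rem/sPi.
have {}sn : (size (rem d s) < n)%N.
  by rewrite size_rem //; case: s ds sn {sPi abE abdE}.
have sum_ge0 : 0 <= ip v (\sum_(e <- rem d s) e).
  elim: (rem d s) sPi => [|e r IHr] rPi; first by rewrite big_nil dot0r.
  have [ePi /IHr r_ge0] := subset_cons rPi.
  by rewrite big_cons dotDr addr_ge0 // ltW // pos_gt0 // simple_pos.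
have [bd|bd] := ltP 0 (ip b d).
  (* If [b = d], the remaining simple roots sum to [- a], against [sum_ge0]. *)
  have neq_bd : b != d.
    apply/eqP => bd_eq; move: abdE; rewrite bd_eq => /addrI/eqP.
    rewrite eqr_oppLR => /eqP aE.
    by have := pos_gt0 aP; rewrite aE dotNr oppr_gt0 ltNge sum_ge0.
  have bdP := pos_sub_simple bP dPi bd neq_bd.
  have [|i [j [ai bdj le_ij wbd]]] := IHn _ sn sPi a (b - d) aP bdP.
    by rewrite addrAC abdE addrC addKr.
  have := degree_add bdj dk; rewrite subrK => /(_ (pos_root bP)) bj.
  exists i, (j + k); split=> // [|ij waP]; first by rewrite (le_trans le_ij) ?lerDl.
  have [k_0 ij'] : k = 0 /\ i = j by clear - ij le_ij k0; lia.
  have := pos_add (wbd ij' waP) (wd k_0); rewrite -linearD /= subrK; apply.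
  exact/weyl_root/pos_root.
have ad : ip a d < 0 by move: d_gt0; rewrite dotDl dotNl; lra.
have [ad0|adD] := root_add (pos_root aP) (pos_root dP) ad.
  by have := pos_opp aP; rewrite (addr0_eq ad0) dP.
have [|i [j [adi bj le_ij wad]]] := IHn _ sn sPi (a + d) b (pos_add aP dP adD) bP.
  by rewrite opprD addrA abdE addrAC subrr add0r.
have [i' ai'] := root_degree (pos_root aP).
have iE := degree_unique adi (degree_add ai' dk adD).
exists i', j; split=> // [|ij waP]; first by rewrite (le_trans _ le_ij) // iE lerDl.
have [k_0 ij'] : k = 0 /\ i = j by clear - ij iE le_ij k0; lia.
apply: wad => //; rewrite linearD pos_add ?wd // -linearD; exact: weyl_root.
Qed.

(** Both roots have degree 1, so by [root_le_degree] a positive [w mu] would force [w g] to be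
    positive. *)
Lemma inversions1_lower_ideal : lower_ideal D Dp I.
Proof.
split=> [|g mu gI mu1 le_mu_g]; first exact: fsubsetIr.
have := gI; rewrite !inversion1E => /andP[wgP g1]; rewrite mu1 andbT.
have muP := degree_pos (lexx 1) mu1; have gP := degree_pos (lexx 1) g1.
have [wmuP|//] := pos_or_neg (weyl_root w_weyl (pos_root muP)).
have [i [j [mui gj _]]] := root_le_degree muP gP le_mu_g.
rewrite (degree_unique mui mu1) (degree_unique gj g1) => /(_ erefl wmuP).
by move/pos_opp; rewrite wgP.
Qed.

End WeylElement.

(** * The characterisation of W^0_min *)

Lemma W0minE w : W0min ip Delta D Dp w <->
  W0 ip Delta Dp Dp0 w /\
  (forall a, a \in Pi -> degree_ge D (-1) ((w^-1)%VF a)).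
Proof.
split=> [[J [J1 _] [[w_weyl NJ] _]]|[[w_weyl w_W0] w_simple]].
  split=> [|a aPi].
    split=> // a /pos0_sub[a0 aP].
    have [//|waP] := pos_or_neg (weyl_root w_weyl (pos_root aP)).
    (* Elements of <J> have degree at least 1, so a root of degree 0 is no inversion. *)
    have /NJ/(sum_closure_degree J1)[i + ai] : a \in inversions Dp w.
      by rewrite inversionsE aP.
    by rewrite -(degree_unique a0 ai).
  have aP := simple_pos aPi; have vaD := weylV_root w_weyl (pos_root aP).
  have [i vai] := root_degree vaD; exists i => //.
  rewrite leNgt; apply/negP => i_lt.
  have wN : - w (- (w^-1)%VF a) = a by rewrite linearN /= weylVK ?opprK.
  (* Level 0 of the closure is [J], excluded because this root has degree at least 2; at level k + 1
     it is a sum of two inversions. *)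
  have /NJ[[|k]] : - (w^-1)%VF a \in inversions Dp w.
    rewrite inversionsE wN aP andbT.
    by apply: degree_pos (degree_opp vai); clear - i_lt; lia.
  - move=> /(fsubsetP J1)/(degree_unique (degree_opp vai)).
    by clear - i_lt; lia.
  rewrite /= in_fsetI => /andP[/imfset2P[b bJ [c ck bcE]] _].
  have /NJ : sum_closure Delta J b by exact: sum_closure_gen.
  rewrite inversionsE => /andP[_ wbP].
  have /NJ : sum_closure Delta J c by exists k.
  rewrite inversionsE => /andP[_ wcP].
  have := simple_indecomposable aPi wbP wcP.
  by rewrite -[a in a != _]wN bcE linearD opprD eqxx.
exists (inversions Dp w `&` D 1); first exact: inversions1_lower_ideal.
have NE g : g \in inversions Dp w <->
    sum_closure Delta (inversions Dp w `&` D 1) g.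
  split; first exact: inversions_closure.
  exact/sum_closure_inversion/fsubsetIl.
(* Uniqueness: the inversion set determines the element. *)
split=> // u [u_weyl uE]; apply: inversions_inj => //.
by apply/fsetP => g; apply/idP/idP; [move/NE/uE | move/uE/NE].
Qed.

End Grading.
End PositiveRoots.
End RootSystem.

Theorem theorem3p8 (R : realType) (V : vectType R) (ip : {dot V for idfun})
  (Delta : {fset V}) (D : int -> {fset V}) (Dp Dp0 : {fset V})
  (Delta_root : root_system ip Delta)
  (Delta_cryst : crystallographic ip Delta)
  (Delta_red : reduced Delta)
  (Delta_irr : irreducible ip Delta)
  (D_grading : Zgrading Delta D)
  (Dp_pos : positive_system ip Delta Dp)
  (Dp_compat : compatible ip D Dp Dp0)
  (w : 'End(V)) :
  W0min ip Delta D Dp w <->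
  W0 ip Delta Dp Dp0 w /\
  (forall a, a \in simple_roots Dp -> degree_ge D (-1) ((w^-1)%VF a)).
Proof.
by case: Dp_pos => v [v_regular DpE]; subst Dp; exact: W0minE.
Qed.
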